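(* Let $m,n\ge2$ be integers with $m$ even, and let $\mathcal{A}\in T_{m,n}$ be row diagonal. Then the following are equivalent: (a) The majorization matrix $M(\mathcal{A})$ is a column adequate matrix. (b) $\mathcal{A}$ is a column adequate tensor. (c) $TCP(q,\mathcal{A})$ has an $\omega$-unique solution for all $q\in\mathbb{R}^n$; i.e. for each $q$ all solutions $x$ of $TCP(q,\mathcal{A})$ give the same vector $\omega=\mathcal{A}x^{m-1}+q$.
   Context: $[n]=\{1,\dots,n\}$. $T_{m,n}$ denotes the set of real tensors $\mathcal{A}=(a_{i_1 i_2\cdots i_m})$ of order $m$ and dimension $n$. For $x\in\mathbb{R}^n$, $\mathcal{A}x^{m-1}\in\mathbb{R}^n$ is the vector with components $(\mathcal{A}x^{m-1})_i=\sum_{i_2,\dots,i_m=1}^n a_{i i_2\cdots i_m}x_{i_2}\cdots x_{i_m}$. Vector inequalities are componentwise. $TCP(q,\mathcal{A})$, for $q\in\mathbb{R}^n$: find $x\in\mathbb{R}^n$ with $x\ge0$, $\omega=\mathcal{A}x^{m-1}+q\ge0$, $x^T\omega=0$. $\omega$-uniqueness means that all solutions share the same $\omega$; existence of a solution is not asserted. Row diagonal: $\mathcal{A}$ is row diagonal if $a_{ii_2\cdots i_m}$ can be nonzero only when $i_2=\cdots=i_m$. Majorization matrix: $M(\mathcal{A})\in\mathbb{R}^{n\times n}$ with $M(\mathcal{A})_{ij}=a_{ijj\cdots j}$. Column adequate tensor: for every $x\in\mathbb{R}^n$, $x_i(\mathcal{A}x^{m-1})_i\le 0$ for all $i\in[n]$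 implies $\mathcal{A}x^{m-1}=0$. Column adequate matrix $M\in\mathbb{R}^{n\times n}$: for every $z\in\mathbb{R}^n$, $z_i(Mz)_i\le0$ for all $i\in[n]$ implies $Mz=0$. *)

(* Defs.v *)
From mathcomp Require Import all_boot all_order all_algebra.
From mathcomp Require Import reals.

Set Implicit Arguments.
Unset Strict Implicit.
Unset Printing Implicit Defensive.

Import Order.TTheory GRing.Theory Num.Theory.
Local Open Scope ring_scope.

(* The entry a_{i_1 ... i_m} is A t with t = [tuple i_1; ...; i_m]; the indices
   are 0-based, in 'I_n. *)
Definition tensor (R : realType) (m n : nat) := {ffun m.-tuple 'I_n -> R}.

(* For m > 0 the tuples t with ohead t = Some i are exactly the index tuples
   (i, i_2, ..., i_m), and behead t is the sequence (i_2, ..., i_m). *)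
Definition tensor_app (R : realType) (m n : nat) (A : tensor R m n)
    (x : 'cV[R]_n) : 'cV[R]_n :=
  \col_i \sum_(t : m.-tuple 'I_n | ohead t == Some i)
            A t * \prod_(j <- behead t) x j 0.

Definition row_diagonal (R : realType) (m n : nat) (A : tensor R m n) : Prop :=
  forall t : m.-tuple 'I_n, A t != 0 -> constant (behead t).

Definition majorization_mx (R : realType) (m n : nat) (A : tensor R m n) :
    'M[R]_n :=
  \matrix_(i, j) A [tuple (if k == 0%N :> nat then i else j) | k < m].

Definition column_adequate_mx (R : realType) (n : nat) (M : 'M[R]_n) : Prop :=
  forall z : 'cV[R]_n,
    (forall i, z i 0 * (M *m z) i 0 <= 0) -> M *m z = 0.

Definition column_adequate_tensor (R : realType) (m n : nat)
    (A : tensor R m n) : Prop :=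
  forall x : 'cV[R]_n,
    (forall i, x i 0 * (tensor_app A x) i 0 <= 0) -> tensor_app A x = 0.

Definition TCP_slack (R : realType) (m n : nat) (q : 'cV[R]_n)
    (A : tensor R m n) (x : 'cV[R]_n) : 'cV[R]_n :=
  tensor_app A x + q.

Definition TCP_solution (R : realType) (m n : nat) (q : 'cV[R]_n)
    (A : tensor R m n) (x : 'cV[R]_n) : Prop :=
  [/\ forall i, 0 <= x i 0,
      forall i, 0 <= TCP_slack q A x i 0
    & (x^T *m TCP_slack q A x) 0 0 = 0].

(* Existence of a solution is deliberately not part of this property. *)
Definition TCP_omega_unique (R : realType) (m n : nat) (q : 'cV[R]_n)
    (A : tensor R m n) : Prop :=
  forall x y : 'cV[R]_n, TCP_solution q A x -> TCP_solution q A y ->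
    TCP_slack q A x = TCP_slack q A y.

(* Main.v *)
(* A row diagonal tensor acts by [A x^(m-1) = M z], where [M] is its majorization
   matrix and [z i = x i ^ (m-1)].  As [m - 1] is odd, [x |-> z] is a
   sign-preserving bijection of R^n, so all three conditions reduce to conditions
   on [M].  Two solutions [z, z'] of the linear problem with slacks [w, w'] satisfy
   [(z i - z' i) * (w i - w' i) <= 0], so adequacy gives [w = w'].  Conversely, if
   [u = M z] satisfies [z i * u i <= 0] for all [i], then the positive and negative
   parts of [z] solve the problem with [q = u^+ - M z^+], with slacks [u^+] and
   [u^-]; uniqueness gives [u^+ = u^-], that is [u = 0]. *)
Require Import Defs.
From mathcomp Require Import all_boot all_order all_algebra.
From mathcomp Require Import reals.

Set Implicit Arguments.
Unset Strict Implicit.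
Unset Printing Implicit Defensive.

Import Order.TTheory GRing.Theory Num.Theory.
Local Open Scope ring_scope.

Lemma odd_root_exists (R : rcfType) (k : nat) (a : R) :
  odd k -> exists y : R, y ^+ k = a.
Proof.
move=> ok; have k_gt0 : (0 < k)%N by case: k ok.
(* As [b >= 1], [b ^+ k >= b >= |a|], so for odd [k] the polynomial ['X^k - a] changes sign on
   [[-b, b]]. *)
pose b := 1 + `|a|.
have b_ge1 : 1 <= b by rewrite lerDl.
have b_ge0 : 0 <= b by exact: le_trans ler01 b_ge1.
have le_a_bk : `|a| <= b ^+ k.
  by apply: le_trans (ler_eXnr k_gt0 b_ge1); rewrite lerDr.
have [||y _ /rootP] := @poly_ivt R ('X^k - a%:P) (- b) b; first by rewrite ge0_cp.
  apply/andP; split.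
  - rewrite !hornerE exprNn -signr_odd ok expr1 mulN1r.
    by rewrite -opprD oppr_le0 -lerBlDr sub0r (le_trans _ le_a_bk) // -normrN ler_norm.
  - by rewrite !hornerE subr_ge0 (le_trans (ler_norm a)).
by rewrite !hornerE => /eqP; rewrite subr_eq0 => /eqP; exists y.
Qed.

Lemma odd_root_mx_exists (R : rcfType) (k p n : nat) (B : 'M[R]_(p, n)) :
  odd k -> exists C : 'M[R]_(p, n), map_mx (fun a => a ^+ k) C = B.
Proof.
move=> ok; have /fin_all_exists[f hf] (ij : 'I_p * 'I_n) :
    exists b, b ^+ k = B ij.1 ij.2.
  exact: odd_root_exists.
by exists (\matrix_(i, j) f (i, j)); apply/matrixP => i j; rewrite !mxE hf.
Qed.

(** For [x != 0] the even power [x ^+ k.-1] is positive and can be cancelled. *)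
Lemma expr_odd_mul_le0 (R : realDomainType) (k : nat) (x a : R) :
  odd k -> (x ^+ k * a <= 0) = (x * a <= 0).
Proof.
case: k => //= k ek; have [->|x0] := eqVneq x 0; first by rewrite expr0n.
have xk_gt0 : 0 < x ^+ k by rewrite lt0r expf_neq0 ?exprn_even_ge0.
by rewrite exprSr -mulrA pmulr_rle0.
Qed.

Section RowDiagonalAction.
Variables (R : realType) (m n : nat).
Implicit Types (i j : 'I_n) (A : tensor R m.+2 n) (x z : 'cV[R]_n).

(** In this form [ohead] and [behead] of the tuple compute. *)
Lemma val_majorization_tuple i j :
  [tuple (if k == 0%N :> nat then i else j) | k < m.+2] = i :: nseq m.+1 j :> seq _.
Proof.
apply: (@eq_from_nth _ i) => [|k]; first by rewrite size_tuple /= size_nseq.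
rewrite size_tuple => lt_km.
rewrite -[k]/(val (Ordinal lt_km)) -tnth_nth tnth_mktuple.
case: k lt_km => [//|k] lt_km.
by rewrite -[RHS]/(nth i (nseq m.+1 j) k) nth_nseq -ltnS lt_km.
Qed.

Lemma tensor_app_row_diagonal A x : row_diagonal A ->
  tensor_app A x = majorization_mx A *m map_mx (fun a => a ^+ m.+1) x.
Proof.
move=> dA; apply/matrixP => i c; rewrite ord1 {c} !mxE.
rewrite (bigID (fun t : m.+2.-tuple 'I_n => constant (behead t))) /=.
rewrite addrC big1 ?add0r => [|t /andP[_ nct]]; last first.
  have [->|/dA ct] := eqVneq (A t) 0; first by rewrite mul0r.
  by rewrite ct in nct.
(* The surviving tuples are [(i, j, ..., j)]. Position 1 recovers [j]; it exists because the order
   is at least 2, so the default of [nth] is never returned. *)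
rewrite (reindex_onto
  (fun j => [tuple (if k == 0%N :> nat then i else j) | k < m.+2])
  (fun t : m.+2.-tuple 'I_n => nth i t 1)) => [|t /andP[]]; last first.
  case: t => [[|i' [|j s]] //= sz] /eqP[ei] /all_pred1P es; subst i'.
  apply: val_inj; rewrite [LHS]val_majorization_tuple /=.
  by move: sz => /eqP[sz]; rewrite [in RHS]es sz.
apply: eq_big => j.
  rewrite val_majorization_tuple /= !eqxx andbT.
  by apply/all_pred1P; rewrite size_nseq.
move=> _; rewrite !mxE val_majorization_tuple.
by rewrite -[behead _]/(nseq m.+1 j) big_nseq iter_mulr_1.
Qed.

Lemma column_adequate_row_diagonal A : ~~ odd m -> row_diagonal A ->
  column_adequate_mx (majorization_mx A) <-> column_adequate_tensor A.
Proof.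
move=> em dA; split=> [adM x hx | adA z hz].
  rewrite tensor_app_row_diagonal //; apply: adM => i.
  by rewrite [X in X * _]mxE expr_odd_mul_le0 // -tensor_app_row_diagonal.
have [y yz] : exists y, map_mx (fun a => a ^+ m.+1) y = z.
  exact: odd_root_mx_exists.
have Ay : tensor_app A y = majorization_mx A *m z.
  by rewrite tensor_app_row_diagonal // yz.
rewrite -Ay; apply: adA => i.
by rewrite Ay -(@expr_odd_mul_le0 _ m.+1) //; have := hz i; rewrite -{1}yz mxE.
Qed.

End RowDiagonalAction.

(** A sum of nonnegative terms vanishes only if each term does, so complementarity holds
    coordinatewise. *)
Lemma TCP_solutionP (R : realType) (m n : nat) (q : 'cV[R]_n)
    (A : tensor R m n) (x : 'cV[R]_n) :
  TCP_solution q A x <->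
  forall i, [/\ 0 <= x i 0, 0 <= TCP_slack q A x i 0
              & x i 0 * TCP_slack q A x i 0 = 0].
Proof.
set w := TCP_slack q A x.
have dotE : (x^T *m w) 0 0 = \sum_i x i 0 * w i 0.
  by rewrite mxE; apply: eq_bigr => i _; rewrite mxE.
rewrite /TCP_solution -/w; split=> [[x0 w0 xw] i | h].
  split=> //; move: xw; rewrite dotE => /psumr_eq0P -> //.
  by move=> j _; rewrite mulr_ge0.
split=> [i|i|]; [by case: (h i) | by case: (h i) |].
by rewrite dotE big1 // => i _; case: (h i).
Qed.

Section AdequacyUniqueness.
Variables (R : realType) (m n : nat) (A : tensor R m.+2 n).
Hypothesis dA : row_diagonal A.
Let M := majorization_mx A.

Lemma adequate_TCP_omega_unique (q : 'cV[R]_n) :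
  column_adequate_mx M -> TCP_omega_unique q A.
Proof.
move=> adM x y /TCP_solutionP hx /TCP_solutionP hy.
pose p (v : 'cV[R]_n) := map_mx (fun a => a ^+ m.+1) v.
have slackB : M *m (p x - p y) = TCP_slack q A x - TCP_slack q A y.
  by rewrite /TCP_slack !tensor_app_row_diagonal // mulmxBr opprD addrACA subrr addr0.
apply/eqP; rewrite -subr_eq0 -slackB; apply/eqP/adM => i.
rewrite slackB; move: (hx i) (hy i).
move: (TCP_slack q A x) (TCP_slack q A y) => w v [x0 w0 xw] [y0 v0 yv].
(* Splitting one factor off each power exposes [x i * w i = 0] and [y i * v i = 0]; only the cross
   terms remain, with a minus sign. *)
rewrite !mxE mulrBl !mulrBr !exprSr -!mulrA xw yv !mulr0 sub0r subr0.
by rewrite -opprD oppr_le0 addr_ge0 // !mulr_ge0 ?exprn_ge0.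
Qed.

Lemma TCP_omega_unique_adequate : ~~ odd m ->
  (forall q : 'cV[R]_n, TCP_omega_unique q A) -> column_adequate_mx M.
Proof.
move=> em uniq z hz; set u := M *m z in hz *.
pose pos (v : 'cV[R]_n) := map_mx (fun a => Num.max a 0) v.
have posB v : pos v - pos (- v) = v.
  apply/matrixP => i c; rewrite !mxE.
  have /orP[v0|v0] := le_total 0 (v i c).
    by rewrite max_l // max_r ?oppr_le0 // subr0.
  by rewrite max_r // max_l ?oppr_ge0 // sub0r opprK.
have pos_ge0 v i : 0 <= pos v i 0 by rewrite mxE le_max lexx orbT.
have pos_mul0 (v w : 'cV[R]_n) i : v i 0 * w i 0 <= 0 -> pos v i 0 * pos w i 0 = 0.
  rewrite !mxE; case: (lerP (v i 0) 0) => [v0|v0]; first by rewrite mul0r.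
  by rewrite pmulr_rle0 // => w0; rewrite max_r // mulr0.
pose q := pos u - M *m pos z.
(* Stated for general [v], [w] to serve both [(z, u)] and [(- z, - u)]; the solution is the root of
   [pos v]. *)
have sol (v w : 'cV[R]_n) : (forall i, v i 0 * w i 0 <= 0) ->
    M *m pos v + q = pos w ->
    exists2 x, TCP_solution q A x & TCP_slack q A x = pos w.
  move=> vw ew; have [x ex] : exists x, map_mx (fun a => a ^+ m.+1) x = pos v.
    exact: odd_root_mx_exists.
  have x0 i : 0 <= x i 0.
    by rewrite -(@exprn_odd_ge0 _ m.+1) //; have := pos_ge0 v i; rewrite -ex mxE.
  have sx : TCP_slack q A x = pos w.
    by rewrite /TCP_slack tensor_app_row_diagonal // ex.
  (* Complementarity passes from [pos v] to [x], since a positive power vanishes only with its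
     base. *)
  exists x => //; apply/TCP_solutionP => i; rewrite sx; split=> //.
  apply/eqP; have /eqP := pos_mul0 _ _ _ (vw i).
  by rewrite -{1}ex [X in X * _]mxE !mulf_eq0 expf_eq0.
have [|| x sx wx] := sol z u => //; first by rewrite addrC subrK.
have [i|| y sy wy] := sol (- z) (- u).
- by rewrite !mxE mulrNN; have := hz i; rewrite mxE.
(* Here [M z^- + q = u^+ - M (z^+ - z^-) = u^+ - u = u^-]. *)
- rewrite /q addrCA -opprB -mulmxBr posB -/u -[X in _ - X]posB.
  by rewrite opprB addrC subrK.
by rewrite -[LHS]posB -wx -wy (uniq q x y) // subrr.
Qed.

End AdequacyUniqueness.

Theorem theorem3p12 (R : realType) (m n : nat) (A : tensor R m n)
    (hm : (2 <= m)%N) (hn : (2 <= n)%N) (hme : ~~ odd m)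
    (hA : row_diagonal A) :
  (column_adequate_mx (majorization_mx A) <-> column_adequate_tensor A) /\
  (column_adequate_tensor A <-> (forall q : 'cV[R]_n, TCP_omega_unique q A)).
Proof.
case: m A hm hme hA => [|[|m]] // A _; rewrite /= negbK => em dA.
have ab := column_adequate_row_diagonal em dA; split=> //; rewrite -ab.
split=> [adM q|]; first exact: adequate_TCP_omega_unique.
exact: TCP_omega_unique_adequate.
Qed.
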